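(* Let $p$ be an odd prime, let $G$ be a finite $p$-group of nilpotency class $2$ with exponent $p$, and let $w=w(x_1,\dots,x_n)$ be a group word. Then either (i) $P_w^G(g)=\frac{1}{|G|}$ for all $g\in G$; or (ii) there is an integer $t$, depending on $w$, such that $P_w^G(g)=\frac{1}{|G|}\zeta_G(t,g)$ for all $g\in G$.
   Context: For a finite group $G$ and a group word $w(x_1,\dots,x_n)$, with associated word map $w:G^{n}\to G$, $P_w^G(g)=\#\{\mathbf{g}\in G^{n}: w(\mathbf{g})=g\}/|G|^n$ for $g\in G$. For a complex number $s$ and $g\in G$, $\zeta_G(s,g)=\sum_{\chi\in\mathrm{Irr}(G)}\chi(g)\,\chi(1)^{-s}$, where $\mathrm{Irr}(G)$ is the set of irreducible complex characters of $G$. *)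

(* Defs.v *)
From HB Require Import structures.
From mathcomp Require Import all_boot all_order all_algebra.
From mathcomp Require Import all_fingroup all_solvable all_field all_character.

Set Implicit Arguments.
Unset Strict Implicit.
Unset Printing Implicit Defensive.

Import GRing.Theory Num.Theory.
Local Open Scope ring_scope.

(* A letter (i, b) stands for x_i if b = false and for x_i^-1 if b = true.
   Words need not be reduced: every element of the free group on n generators
   is represented, and free reduction does not change the word map. *)
Definition gword (n : nat) : Type := seq ('I_n * bool).

Definition word_map (gT : finGroupType) (n : nat) (w : gword n)
    (x : {ffun 'I_n -> gT}) : gT :=
  (\prod_(l <- w) (if l.2 then (x l.1)^-1 else x l.1))%g.

Definition word_prob (gT : finGroupType) (G : {group gT}) (n : nat)
    (w : gword n) (g : gT) : algC :=
  #|[set x : {ffun 'I_n -> gT} in ffun_on G | word_map w x == g]|%:R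
    / #|G|%:R ^+ n.

(* Restricted to integer s, where the power is the integer power in algC.
   The complex characters of a finite group take their values in algC. *)
Definition char_zeta (gT : finGroupType) (G : {group gT}) (s : int)
    (g : gT) : algC :=
  \sum_(i : Iirr G) 'chi_i g * 'chi_i 1%g ^ (- s).

(* Main.v *)
Require Import Defs.
From mathcomp Require Import all_boot all_order all_algebra.
From mathcomp Require Import all_fingroup all_solvable all_field all_character.
Local Open Scope ring_scope.

Set Implicit Arguments.
Unset Strict Implicit.
Unset Printing Implicit Defensive.
Import GRing.Theory Num.Theory.

(** In a group of class 2 and exponent p a word behaves like a linear form plus
an alternating form over the field with p elements, and the theorem is the
reduction of that alternating form to a sum of hyperbolic planes, carried out
by substitutions in one variable at a time.

Moving all occurrences of a variable y to the left gives
  w = y^e * w0 * [y, u]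
with w0 and u free of y ([word_fun_isolate]).  If p does not divide e then, for
fixed values of the other variables, y |-> w is a bijection of G and the value
of w is uniformly distributed ([prob_uniform]); this is the first alternative.
Otherwise w = w0 * [y, u].  If u is always central, the commutator disappears
and y with it.  If not, up to central factors u = z^d * u0 with p not dividing
d and u0 free of z, and the substitution replacing u by z gives w = w1 * [y, z],
where w1 is free of y.  Isolating z in w1 either exhibits a uniform
distribution again, or gives w = w2 * [z, v * y^-1] with w2 and v free of y and
z; the substitution replacing v * y^-1 by y leaves w = w2 * [z, y].  By
induction on the number of variables a nonuniform w is distributed like a
product of r independent random commutators, for some r ([word_fun_dist]).

For the latter distribution Frobenius' formula
  sum_(a, b in G) chi (g [a, b]^-1) = |G|^2 chi(g) / chi(1)^2
shows that each commutator factor adds 2 to the parameter of the zeta function.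
With no commutator at all the distribution is concentrated at 1, which is
zeta at -1 by the decomposition of the regular character.  Hence the second
alternative holds with t = 2 r - 1 ([comm_dist_zeta]).

The reduction is carried out in a group that is a whole type; it is applied
to the type of the elements of G. *)

(** * Frobenius' formula for commutators *)

Section Frobenius.
Variables (gT : finGroupType) (G : {group gT}).

(** The left hand side is a class function of [b].  By the generalized
orthogonality relations it is orthogonal to every irreducible character except
['chi_i], so it is a multiple of ['chi_i]. *)
Lemma sum_irr_mulJ (i : Iirr G) (a b : gT) : a \in G -> b \in G ->
  \sum_(z in G) 'chi_i (a * b ^ z)%g
    = #|G|%:R * ('chi_i a * 'chi_i b / 'chi_i 1%g).
Proof.
move=> aG bG.
pose F x := if x \in G then \sum_(z in G) 'chi_i (a * x ^ z)%g else 0.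
have FJ : {in G &, forall x y, F (x ^ y)%g = F x}.
  move=> x y xG yG; rewrite /F groupJ ?xG //.
  rewrite [RHS](reindex_inj (mulgI y)) /=.
  by apply: eq_big => z; rewrite ?groupMl // => _; rewrite conjgM.
have F0 x : x \notin G -> F x = 0 by rewrite /F => /negPf->.
have clF : is_class_fun <<G>>%g [ffun x => F x].
  by rewrite genGid; apply: intro_class_fun.
pose phi : 'CF(G) := Cfun 0 clF.
have phiE x : phi x = F x by rewrite cfunE.
have coordF j : '[phi, 'chi_j] = (i == j)%:R * (#|G|%:R * ('chi_i a / 'chi_i 1%g)).
  rewrite cfdotE.
  transitivity (\sum_(z in G)
     (#|G|%:R^-1 * \sum_(x in G) 'chi_i (x * a)%g * 'chi_j x^-1%g)).
    rewrite -mulr_sumr; congr (_ * _).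
    under eq_bigr => x xG do rewrite phiE /F xG mulr_suml.
    rewrite exchange_big /=; apply: eq_bigr => z zG.
    rewrite (reindex_inj (conjg_inj z^-1%g)) /=.
    apply: eq_big => x; first by rewrite groupJr ?groupV.
    rewrite groupJr ?groupV // => xG.
    rewrite conjgKV -irr_inv -conjVg cfunJ ?groupV //.
    by rewrite -(cfunJ 'chi_i (x * a) xG) conjgE mulgA mulKg.
    rewrite generalized_orthogonality_relation.
  by rewrite sumr_const -[LHS]mulr_natl mulrCA.
have := cfun_sum_cfdot phi; move/cfunP/(_ b).
rewrite phiE /F bG => ->.
rewrite sum_cfunE (bigD1 i) //= big1 ?addr0; last first.
  by move=> j ji; rewrite cfunE coordF eq_sym (negPf ji) !mul0r.
by rewrite cfunE coordF eqxx mul1r -!mulrA [_^-1 * _]mulrC.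
Qed.

Lemma sum_irr_mul_commg (i : Iirr G) (g : gT) : g \in G ->
  \sum_(a in G) \sum_(b in G) 'chi_i (g * [~ a, b]^-1)%g
    = #|G|%:R ^+ 2 * ('chi_i g / 'chi_i 1%g ^+ 2).
Proof.
move=> gG; rewrite exchange_big /=.
transitivity (\sum_(b in G)
   #|G|%:R * ('chi_i (g * b^-1)%g * 'chi_i b / 'chi_i 1%g)).
  apply: eq_bigr => b bG; rewrite -sum_irr_mulJ ?groupM ?groupV //.
  by apply: eq_bigr => a aG; rewrite invg_comm commgEl mulgA.
rewrite -mulr_sumr -mulr_suml (reindex_inj invg_inj) /=.
rewrite (eq_big (mem G) (fun x => 'chi_i (x * g)%g * 'chi_i x^-1%g)); last first.
- move=> x; rewrite groupV => xG; rewrite invgK.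
  by rewrite -(cfunJ 'chi_i (x * g) xG) conjgE mulgA mulKg.
- by move=> x; rewrite /= groupV.
have := generalized_orthogonality_relation g i i.
rewrite eqxx mul1r => /(canRL (mulKf _)) ->.
  by rewrite invrK !expr2 invfM !mulrA.
by rewrite invr_eq0 neq0CG.
Qed.

End Frobenius.

(** * Words in groups of class 2 and exponent p *)

(** The probability that a product of [r] independent uniform commutators of
elements of [G] equals a given element: each step is a convolution with the
distribution of one commutator. *)
Definition comm_dist (gT : finGroupType) (G : {set gT}) (r : nat) : gT -> algC :=
  iter r
    (fun phi g =>
       (\sum_(a in G) \sum_(b in G) phi (g * [~ a, b]^-1)%g) / #|G|%:R ^+ 2)
    (fun g => (g == 1%g)%:R).

Section ClassTwo.
Local Open Scope group_scope.
Variables (H : finGroupType) (p : nat) (I : finType).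
Hypothesis p_prime : prime p.
Hypothesis commg_central : forall a b c : H, commute [~ a, b] c.
Hypothesis expH : forall a : H, a ^+ p = 1.

Lemma commgJ2 (a b c : H) : [~ a, b] ^ c = [~ a, b].
Proof. by rewrite conjgE commg_central mulKg. Qed.

Lemma commMg2 (a b c : H) : [~ a * b, c] = [~ a, c] * [~ b, c].
Proof. by rewrite commMgJ commgJ2. Qed.

Lemma commgM2 (a b c : H) : [~ a, b * c] = [~ a, b] * [~ a, c].
Proof. by rewrite commgMJ commgJ2 commg_central. Qed.

Lemma commgV2 (a b : H) : [~ a, b^-1] = [~ a, b]^-1.
Proof. by apply/eqP; rewrite eq_sym eq_invg_mul -commgM2 mulgV commg1. Qed.

Lemma commgX2 (a b : H) n : [~ a, b ^+ n] = [~ a, b] ^+ n.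
Proof. by apply: commgX; apply: commute_sym. Qed.

Lemma commXg2 (a b : H) n : [~ a ^+ n, b] = [~ a, b] ^+ n.
Proof. by apply: commXg; apply: commute_sym. Qed.

Lemma expgMc (a b c : H) n : (a * [~ b, c]) ^+ n = a ^+ n * [~ b, c] ^+ n.
Proof. by apply: expgMn; apply: commute_sym. Qed.

(** The inverse of [e] modulo [p]: this is what lets a variable be solved for. *)
Lemma root_exp e : ~~ (p %| e)%N -> exists k, forall a : H, a ^+ e ^+ k = a.
Proof.
rewrite -prime_coprime // coprime_sym => co_ep.
have e_gt0 : (0 < e)%N.
  by case: e co_ep => // /eqP; rewrite gcd0n => p1; move: p_prime; rewrite p1.
have [[k l] /= kl] := coprimeP _ e_gt0 co_ep.
exists k => a.
have kE : (e * k = l * p + 1)%N.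
  by rewrite mulnC -kl addnC subnK // ltnW // -subn_gt0 kl.
by rewrite -expgM kE expgD mulnC expgM expH expg1n mul1g.
Qed.

Lemma divisible_exp e (a : H) : (p %| e)%N -> a ^+ e = 1.
Proof. by case/dvdnP=> k ->; rewrite mulnC expgM expH expg1n. Qed.

Notation point := {ffun I -> H}.

Definition upd (x : point) i a : point := [ffun j => if j == i then a else x j].

Definition indep i (T : Type) (f : point -> T) := forall x a, f (upd x i a) = f x.

(** The functions induced by words in the variables of [S].  Only the function
matters, so the class is closed under pointwise equality; inverses are powers,
as the exponent is finite ([word_funV]). *)
Inductive word_fun (S : {set I}) : (point -> H) -> Prop :=
| word_fun1 : word_fun S (fun=> 1)
| word_fun_var i : i \in S -> word_fun S (fun x => x i)
| word_funM f g : word_fun S f -> word_fun S g -> word_fun S (fun x => f x * g x)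
| word_fun_ext f g : word_fun S f -> f =1 g -> word_fun S g.

Lemma word_funX (S : {set I}) f n : word_fun S f -> word_fun S (fun x => f x ^+ n).
Proof.
move=> wf; elim: n => [|n IHn]; first exact: word_fun1.
by apply: word_fun_ext (word_funM wf IHn) _ => x; rewrite expgS.
Qed.

Lemma word_funV (S : {set I}) f : word_fun S f -> word_fun S (fun x => (f x)^-1).
Proof.
move=> wf; apply: word_fun_ext (word_funX p.-1 wf) _ => x.
by apply/eqP; rewrite eq_sym eq_invg_mul -expgS prednK ?prime_gt0 ?expH.
Qed.

Lemma word_funS (S T : {set I}) f : S \subset T -> word_fun S f -> word_fun T f.
Proof.
move=> /subsetP sST; elim=> {f} [|i /sST iT|f g _ wf _ wg|f g _ wf fg].
- exact: word_fun1.
- exact: word_fun_var.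
- exact: word_funM.
- exact: word_fun_ext wf fg.
Qed.

Lemma word_fun_indep (S : {set I}) i f : i \notin S -> word_fun S f -> indep i f.
Proof.
move=> iS; elim=> {f} [|j jS|f g _ wf _ wg|f g _ wf fg] x a //.
- by rewrite ffunE; case: eqP => // ji; rewrite -ji jS in iS.
- by rewrite wf wg.
- by rewrite -!fg.
Qed.

Lemma word_fun_subst (S : {set I}) i f g : word_fun S f -> word_fun S g ->
  word_fun S (fun x => f (upd x i (g x))).
Proof.
move=> wf wg; elim: wf => {f} [|j jS|f h _ wf _ wh|f h _ wf fh].
- exact: word_fun1.
- have [->|ji] := eqVneq j i.
    by apply: word_fun_ext wg _ => x; rewrite ffunE eqxx.
  by apply: word_fun_ext (word_fun_var jS) _ => x; rewrite ffunE (negPf ji).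
- exact: word_funM.
- by apply: word_fun_ext wf _ => x.
Qed.

(** A variable can be moved across a factor [f0 x] at the price of a central
commutator with it, and bilinearity gathers all these commutators into a single
one. *)
Lemma word_fun_isolate (S : {set I}) i f : word_fun S f ->
  exists e f0 u, [/\ word_fun (S :\ i) f0, word_fun (S :\ i) u &
    forall x, f x = x i ^+ e * f0 x * [~ x i, u x]].
Proof.
have w1 : word_fun (S :\ i) (fun=> 1) by exact: word_fun1.
elim=> {f} [|j jS|f g _ [e [f0 [u [wf0 wu fE]]]] _ [d [g0 [v [wg0 wv gE]]]]
           |f g _ [e [f0 [u [wf0 wu fE]]]] fg].
- by exists 0%N, (fun=> 1), (fun=> 1); split=> // x; rewrite commg1 !mulg1.
- have [->|ji] := eqVneq j i.
    by exists 1%N, (fun=> 1), (fun=> 1); split=> // x; rewrite commg1 !mulg1.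
  exists 0%N, (fun x => x j), (fun=> 1); split=> //.
    by apply: word_fun_var; rewrite !inE ji.
  by move=> x; rewrite commg1 mulg1 mul1g.
- exists (e + d)%N, (fun x => f0 x * g0 x),
    (fun x => u x * v x * (f0 x ^+ d)^-1); split.
  + exact: word_funM.
  + by do 2?apply: word_funM => //; apply/word_funV/word_funX.
  + move=> x; rewrite fE gE expgD !commgM2 commgV2 invg_comm commXg2 -commgX2.
    move: (x i ^+ e) (x i ^+ d) (f0 x) (g0 x) => a b y z.
    have := commgC y b; have := @commg_central y b.
    have := @commg_central (x i) (u x); have := @commg_central (x i) (v x).
    move: [~ x i, u x] [~ x i, v x] [~ y, b] => c c' k c'C cC kC yb.
    rewrite -!mulgA; congr (_ * _).
    rewrite (mulgA c) cC -!mulgA !(mulgA y b) yb -!mulgA; congr (_ * (_ * _)).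
    by rewrite kC -!mulgA (mulgA c') c'C -!mulgA.
- by exists e, f0, u; split=> // x; rewrite -fg.
Qed.

Lemma word_fun_set0 f : word_fun set0 f -> forall x, f x = 1.
Proof.
elim=> {f} [|i|f g _ f1 _ g1|f g _ f1 fg] //.
- by rewrite in_set0.
- by move=> x; rewrite f1 g1 mulg1.
- by move=> x; rewrite -fg.
Qed.

(** Inside a commutator only the class of [u] modulo the center matters, so the
commutators produced by isolating a variable can be dropped.  Variables
are isolated until one has an exponent prime to [p]; if none has, nothing
noncentral remains. *)
Lemma word_fun_central_or_linear (S : {set I}) u : word_fun S u ->
    (forall x b, [~ b, u x] = 1)
  \/ exists i e u0, [/\ i \in S, ~~ (p %| e)%N, word_fun (S :\ i) u0 &
       forall x b, [~ b, u x] = [~ b, x i ^+ e * u0 x]].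
Proof.
have [m] := ubnP #|S|; elim: m S u => // m IHm S u leSm wu.
have [S0|[i iS]] := set_0Vmem S.
  by left=> x b; rewrite S0 in wu; rewrite (word_fun_set0 wu) commg1.
have [e [u0 [v [wu0 _ uE]]]] := word_fun_isolate i wu.
have commuE x b : [~ b, u x] = [~ b, x i ^+ e * u0 x].
  by rewrite uE commgM2 [X in _ * X](_ : _ = 1) ?mulg1 //;
     apply/eqP/commgP/commute_sym/commg_central.
have [pe|npe] := boolP (p %| e)%N; last by right; exists i, e, u0.
have [|u0_central|[j [d [u1 [jS npd wu1 u0E]]]]] := IHm _ _ _ wu0.
- by rewrite -ltnS (leq_trans _ leSm) // ltnS [X in (_ < X)%N](cardsD1 i) iS.
- by left=> x b; rewrite commuE divisible_exp // mul1g.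
right; exists j, d, u1; split=> //.
- by case/setD1P: jS.
- by apply: word_funS wu1; apply/setSD/subsetDl.
- by move=> x b; rewrite commuE divisible_exp // mul1g.
Qed.

(** * Distribution of the values of a word *)

Local Open Scope ring_scope.

Definition prob (f : point -> H) (h : H) : algC :=
  (\sum_x (f x == h)%:R) / #|H|%:R ^+ #|I|.

Lemma cardH_neq0 : #|H|%:R != 0 :> algC.
Proof. by rewrite -cardsT neq0CG. Qed.

Lemma upd_at i (x : point) a : upd x i a i = a.
Proof. by rewrite ffunE eqxx. Qed.

Lemma upd_off i j (x : point) a : j != i -> upd x i a j = x j.
Proof. by rewrite ffunE => /negPf->. Qed.

(** A substitution in one variable is a change of variables as soon as it is
injective in that variable, the other ones being fixed. *)
Lemma upd_inj i (c : point -> H) :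
    (forall x a, c (upd x i a) = c x -> x i = a) ->
  injective (fun x => upd x i (c x)).
Proof.
move=> c_inj x y eq_xy.
have off j : j != i -> x j = y j.
  move=> ji; have := congr1 (fun z : point => z j) eq_xy.
  by rewrite !ffunE (negPf ji).
have yE : y = upd x i (y i).
  by apply/ffunP=> j; rewrite ffunE; have [->|/off->] := eqVneq.
have := congr1 (fun z : point => z i) eq_xy; rewrite !upd_at => cxy.
have /c_inj xy : c (upd x i (y i)) = c x by rewrite -yE.
by rewrite yE -xy; apply/ffunP=> j; rewrite ffunE; case: eqP => // ->.
Qed.

(** Replacing the coordinate [i] by an independent copy: translating that
coordinate by any [b] does not change the sum, and one averages over [b]. *)
Lemma sum_resample i (F : point -> H -> algC) :
    (forall x b a, F (upd x i b) a = F x a) ->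
  \sum_x F x (x i) = #|H|%:R^-1 * \sum_a \sum_x F x a.
Proof.
move=> F_indep; apply: (canRL (mulKf cardH_neq0)).
transitivity (\sum_(b : H) \sum_x F x (x i * b)%g).
  rewrite mulr_natl -sumr_const; apply: eq_bigr => b _.
  rewrite (reindex_inj (@upd_inj i (fun x => x i * b)%g _)) /=.
    by apply: eq_bigr => x _; rewrite F_indep upd_at.
  by move=> x a; rewrite upd_at => /mulIg.
rewrite exchange_big [RHS]exchange_big; apply: eq_bigr => x _ /=.
by rewrite [RHS](reindex_inj (mulgI (x i))).
Qed.

Lemma prob_reindex i c f h : (forall x a, c (upd x i a) = c x -> x i = a) ->
  prob (fun x => f (upd x i (c x))) h = prob f h.
Proof. by move/upd_inj=> c_inj; rewrite /prob [in RHS](reindex_inj c_inj). Qed.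

Lemma eq_prob f g h : f =1 g -> prob f h = prob g h.
Proof. by move=> fg; rewrite /prob; under eq_bigr do rewrite fg. Qed.

Lemma prob_coord i h : prob (fun x => x i) h = #|H|%:R^-1.
Proof.
rewrite /prob (@sum_resample i (fun _ a => (a == h)%:R)) //.
under eq_bigr do rewrite sumr_const card_ffun.
rewrite (bigD1 h) //= eqxx big1 => [|a /negPf->]; last by rewrite mul0rn.
by rewrite addr0 natrX mulfK // expf_neq0 // cardH_neq0.
Qed.

(** Two values of [x i] giving the same word value have, up to central factors,
the same power [e], hence agree modulo the center.  So they have the same
commutator with [u], then the same power [e], and are equal. *)
Lemma prob_uniform i e f0 u h : ~~ (p %| e)%N -> indep i f0 -> indep i u ->
  prob (fun x => x i ^+ e * f0 x * [~ x i, u x])%g h = #|H|%:R^-1.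
Proof.
move=> /root_exp[k ekK] if0 iu.
set f := fun x => _; rewrite -(prob_coord i h) -(@prob_reindex i f (fun x => x i)).
  by apply: eq_prob => x; rewrite upd_at.
move=> x a; rewrite /f if0 iu upd_at.
move: (x i) (f0 x) (u x) => {f if0 iu} b c v.
have swap (y : H) : (y ^+ e * c * [~ y, v] = y ^+ e * [~ y, v] * c)%g.
  by rewrite -(mulgA (y ^+ e)%g c) -commg_central mulgA.
rewrite !swap => /mulIg eq_ab.
have eq_comm : [~ a, v] = [~ b, v].
  have comm1 (y : H) : [~ [~ y, v] ^+ k, v] = 1%g.
    by rewrite commXg2; apply/eqP; rewrite (_ : [~ _, v] = 1%g) ?expg1n //;
       apply/eqP/commgP/commg_central.
  have := congr1 (fun y => [~ y ^+ k, v])%g eq_ab.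
  by rewrite /= !expgMc !ekK !commMg2 !comm1 !mulg1.
move: eq_ab; rewrite eq_comm => /mulIg/(congr1 (fun y => y ^+ k)%g).
by rewrite /= !ekK.
Qed.

(** [x i] and [x j] do not occur in [f], so they can be replaced by
two elements drawn independently of [x]. *)
Lemma prob_mul_commg i j f h : i != j -> indep i f -> indep j f ->
  prob (fun x => f x * [~ x i, x j])%g h =
    (\sum_a \sum_b prob f (h * [~ a, b]^-1)%g) / #|H|%:R ^+ 2.
Proof.
move=> ij fi fj; rewrite /prob.
rewrite (@sum_resample i (fun x a => (f x * [~ a, x j] == h)%g%:R)); last first.
  by move=> x b a; rewrite fi upd_off // eq_sym.
under eq_bigr => a _.
  rewrite (@sum_resample j (fun x b => (f x * [~ a, b] == h)%g%:R)); last first.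
    by move=> x b c; rewrite fj.
  over.
under [in RHS]eq_bigr do rewrite -mulr_suml.
rewrite -mulr_sumr -mulr_suml mulrA -expr2 exprVn mulrC mulrA mulrAC.
congr (_ / _); rewrite mulrC; congr (_ / _).
apply: eq_bigr => a _; apply: eq_bigr => b _; apply: eq_bigr => x _.
by rewrite -[in RHS](inj_eq (mulIg [~ a, b])) mulgKV.
Qed.

(** The symplectic reduction, by induction on the number of variables. *)
Theorem word_fun_dist (S : {set I}) f : word_fun S f ->
    (forall h, prob f h = #|H|%:R^-1)
  \/ exists r, forall h, prob f h = comm_dist [set: H] r h.
Proof.
have [m] := ubnP #|S|; elim: m S f => // m IHm S f leSm wf.
have [S0|[i iS]] := set_0Vmem S.
  right; exists 0%N => h; rewrite S0 in wf.
  rewrite /prob; under eq_bigr do rewrite (word_fun_set0 wf).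
  rewrite sumr_const card_ffun -[_ *+ (_ ^ _)%N]mulr_natr natrX.
  by rewrite mulfK ?expf_neq0 ?cardH_neq0 // eq_sym.
have [e [f0 [u [wf0 wu fE]]]] := word_fun_isolate i wf.
have i_notin : i \notin S :\ i by rewrite !inE eqxx.
have [pe|npe] := boolP (p %| e)%N; last first.
  left=> h; rewrite (eq_prob h fE).
  by apply: prob_uniform npe _ _; apply: word_fun_indep i_notin _.
have ltSm : (#|S :\ i| < m)%N.
  by rewrite -ltnS (leq_trans _ leSm) // ltnS [X in (_ < X)%N](cardsD1 i) iS.
have [u1|[j [d [u0 [jS npd wu0 uE]]]]] := word_fun_central_or_linear wu.
  have fE0 : f =1 f0.
    by move=> x; rewrite fE u1 mulg1 divisible_exp // mul1g.
  have [unif|[r fr]] := IHm _ _ ltSm wf0; [left=> h|right; exists r => h].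
    by rewrite (eq_prob h fE0).
  by rewrite (eq_prob h fE0).
have [ji _] := setD1P jS; have ij : i != j by rewrite eq_sym.
have j_notin T : j \notin T :\ j by rewrite !inE eqxx.
have [k dkK] := root_exp npd.
(* Putting [c x] for [x j] turns [x j ^+ d * u0 x] into [x j]. *)
pose c (x : point) := ((x j * (u0 x)^-1) ^+ k)%g.
have c_dk (x : point) : (c x ^+ d * u0 x)%g = x j.
  by rewrite /c -expgM mulnC expgM dkK mulgKV.
have u0j : indep j u0 by apply: word_fun_indep wu0.
have c_inj (x : point) a : c (upd x j a) = c x -> x j = a.
  move=> /(congr1 (fun y => y ^+ d * u0 x))%g /=.
  by rewrite -[in LHS](u0j x a) !c_dk upd_at.
pose f1 (x : point) := f0 (upd x j (c x)).
have wf1 : word_fun (S :\ i) f1.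
  apply: word_fun_subst => //; apply/word_funX/word_funM; first exact: word_fun_var.
  by apply/word_funV/(word_funS _ wu0)/subsetDl.
have prob_f1 h : prob f h = prob (fun x => f1 x * [~ x i, x j])%g h.
  rewrite -(@prob_reindex j c f h) //; apply: eq_prob => x.
  by rewrite fE uE u0j upd_at c_dk upd_off // divisible_exp // mul1g.
have [e1 [f2 [v [wf2 wv f1E]]]] := word_fun_isolate j wf1.
(* Both commutators involve [x j], and bilinearity merges them. *)
have f1E' (x : point) :
  (f1 x * [~ x i, x j] = x j ^+ e1 * f2 x * [~ x j, v x * (x i)^-1])%g.
  by rewrite f1E -mulgA; congr (_ * _)%g; rewrite commgM2 commgV2 invg_comm.
have f2j : indep j f2 by apply: word_fun_indep wf2.
have vj : indep j v by apply: word_fun_indep wv.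
have [pe1|npe1] := boolP (p %| e1)%N; last first.
  left=> h; rewrite prob_f1 (eq_prob h f1E').
  by apply: prob_uniform npe1 _ _ => // x a; rewrite vj upd_off.
have i_notin2 : i \notin S :\ i :\ j by rewrite !inE eqxx andbF.
have f2i : indep i f2 by apply: word_fun_indep wf2.
have vi : indep i v by apply: word_fun_indep wv.
(* Putting [c' x] for [x i] turns [v x * (x i)^-1] into [x i]. *)
pose c' (x : point) := ((x i)^-1 * v x)%g.
have prob_f2 h : prob f h =
    (\sum_a \sum_b prob f2 (h * [~ a, b]^-1)%g) / #|H|%:R ^+ 2.
  rewrite -(@prob_mul_commg j i) // prob_f1 -(@prob_reindex i c').
    apply: eq_prob => x; rewrite f1E' f2i vi upd_at upd_off //.
    by rewrite /c' divisible_exp // mul1g invMg invgK mulKVg.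
  by move=> x a; rewrite /c' vi upd_at => /mulIg/invg_inj.
have [|unif|[r f2r]] := IHm _ _ _ wf2.
- by apply: leq_ltn_trans ltSm; apply/subset_leq_card/subsetDl.
- left=> h; rewrite prob_f2.
  under eq_bigr do under eq_bigr do rewrite unif.
  rewrite !sumr_const -mulrnA -[X in X / _]mulr_natr natrM -expr2 mulfK //.
  by rewrite expf_neq0 // cardH_neq0.
right; exists r.+1 => h; rewrite prob_f2 /= cardsT; congr (_ / _).
apply: eq_big => [a|a _]; first by rewrite inE.
by apply: eq_big => [b|b _]; rewrite ?inE ?f2r.
Qed.

End ClassTwo.

Lemma word_map_word_fun (H : finGroupType) p (p_prime : prime p)
    (expH : forall a : H, (a ^+ p = 1)%g) n (w : gword n) :
  word_fun [set: 'I_n] (fun x : {ffun 'I_n -> H} => word_map w x).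
Proof.
elim: w => [|l w IHw].
  by apply: word_fun_ext (word_fun1 _ _) _ => x; rewrite /word_map big_nil.
pose letter (x : {ffun 'I_n -> H}) := (if l.2 then (x l.1)^-1 else x l.1)%g.
have wl : word_fun [set: 'I_n] letter.
  rewrite /letter; case: (l) => k [] /=; first apply: (word_funV p_prime expH).
    by apply: word_fun_var; rewrite inE.
  by apply: word_fun_var; rewrite inE.
by apply: word_fun_ext (word_funM wl IHw) _ => x; rewrite /word_map big_cons.
Qed.

(** * From the group to the type of its elements *)

Section Restriction.
Variables (gT : finGroupType) (G : {group gT}).

(** The regular character gives the case [r = 0], and Frobenius' formula adds
2 to the exponent at each further commutator. *)
Lemma comm_dist_zeta r (g : gT) : g \in G ->
  comm_dist G r g = #|G|%:R^-1 * char_zeta G ((2 * r)%:Z - 1) g.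
Proof.
have chi1_neq0 (i : Iirr G) : 'chi_i 1%g != 0 by apply: irr1_neq0.
elim: r g => [|r IHr] g gG.
  rewrite muln0 sub0r /char_zeta opprK /=.
  under eq_bigr => i _ do rewrite expr1z.
  have /(congr1 (fun phi : 'CF(G) => phi g)) := cfReg_sum G.
  rewrite cfRegE sum_cfunE => regE.
  transitivity (#|G|%:R^-1 * (#|G|%:R *+ (g == 1%g)) : algC).
    by rewrite mulrnAr mulVf // neq0CG.
  by rewrite regE; congr (_ * _); apply: eq_bigr => i _; rewrite cfunE mulrC.
rewrite /comm_dist iterS -/(comm_dist G r).
transitivity ((\sum_(a in G) \sum_(b in G) \sum_(i : Iirr G)
   'chi_i (g * [~ a, b]^-1)%g * (#|G|%:R^-1 * 'chi_i 1%g ^ (- ((2 * r)%:Z - 1))))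
   / #|G|%:R ^+ 2).
  congr (_ / _); apply: eq_bigr => a aG; apply: eq_bigr => b bG.
  rewrite IHr ?groupM ?groupV ?groupR // /char_zeta mulr_sumr.
  by apply: eq_bigr => i _; rewrite mulrCA.
under eq_bigr do rewrite exchange_big.
rewrite exchange_big mulr_suml /char_zeta mulr_sumr; apply: eq_bigr => i _ /=.
under eq_bigr do rewrite -mulr_suml.
rewrite -mulr_suml sum_irr_mul_commg //.
have -> : - ((2 * r.+1)%:Z - 1) = - ((2 * r)%:Z - 1) + -2%:Z :> int.
  by rewrite -opprD mulnS PoszD [X in X - 1]addrC addrAC.
rewrite expfzDr // -exprnN.
rewrite mulrAC [#|G|%:R ^+ 2 * _]mulrC mulfK ?expf_neq0 ?neq0CG //.
by rewrite mulrCA -!mulrA [_^-1 * (_ ^ _)]mulrC.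
Qed.

Let subG := [subg G].

Lemma sum_subg (F : gT -> algC) :
  \sum_(a in G) F a = \sum_(a in [set: subG]) F (sgval a).
Proof.
rewrite (reindex_onto sgval (subg G)) => [|a]; last exact: subgK.
by apply: eq_bigl => a; rewrite sgvalK eqxx inE subgP.
Qed.

Lemma comm_dist_subg r (h : subG) :
  comm_dist [set: subG] r h = comm_dist G r (sgval h).
Proof.
elim: r h => [|r IHr] h //=.
rewrite sum_subg -(card_isog (isog_subg G)); congr (_ / _).
apply: eq_bigr => a _; rewrite sum_subg; apply: eq_bigr => b _.
exact: IHr.
Qed.

Lemma word_map_subg n (w : gword n) (x : {ffun 'I_n -> subG}) :
  word_map w [ffun k => sgval (x k)] = sgval (word_map w x).
Proof.
rewrite /word_map (big_morph sgval (id1 := 1%g) (op1 := mulg)) //.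
by apply: eq_bigr => -[k []] _ /=; rewrite ffunE.
Qed.

Lemma word_prob_subg n (w : gword n) (g : gT) : g \in G ->
  word_prob G w g = prob (fun x : {ffun 'I_n -> subG} => word_map w x) (subg G g).
Proof.
move=> gG; rewrite /word_prob /prob card_ord -cardsT -(card_isog (isog_subg G)).
congr (_ / _); rewrite -sum1_card natr_sum.
rewrite (reindex_onto (fun x : {ffun 'I_n -> subG} => [ffun k => sgval (x k)])
  (fun x => [ffun k => subg G (x k)])) /=; last first.
  move=> x; rewrite inE => /andP[/ffun_onP xG _].
  by apply/ffunP=> k; rewrite !ffunE subgK.
rewrite big_mkcond; apply: eq_bigr => x _.
have -> : [ffun k => subg G ([ffun k0 => sgval (x k0)] k)] = x.
  by apply/ffunP=> k; rewrite !ffunE sgvalK.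
rewrite eqxx andbT inE word_map_subg -[in LHS](@subgK _ _ _ gG) (inj_eq val_inj).
rewrite (introT ffun_onP); last by move=> k; rewrite ffunE subgP.
by rewrite /=; case: eqP.
Qed.

End Restriction.

Theorem corollary3p2 (p : nat) (p_prime : prime p) (p_odd : odd p)
    (gT : finGroupType) (G : {group gT}) (pG : (p.-group G)%g)
    (class2 : nil_class G = 2%N) (expG : exponent G = p)
    (n : nat) (w : gword n) :
  (forall g : gT, g \in G -> word_prob G w g = #|G|%:R^-1) \/
  (exists t : int, forall g : gT, g \in G ->
     word_prob G w g = #|G|%:R^-1 * char_zeta G t g).
Proof.
have derG : (G^`(1) \subset 'Z(G))%g by rewrite -nil_class2 class2.
have central (a b c : [subg G]) : commute [~ a, b] c.
  apply: val_inj; have /centerP[_] : sgval [~ a, b]%g \in 'Z(G)%g.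
    by apply/(subsetP derG)/mem_commg; apply: subgP.
  by apply; apply: subgP.
have expH (a : [subg G]) : (a ^+ p = 1)%g.
  apply: val_inj; rewrite /= (morphX (sgval_morphism G)) ?inE //.
  by rewrite -expG expg_exponent ?subgP.
have wf := word_map_word_fun p_prime expH w.
have [unif|[r wr]] := word_fun_dist p_prime central expH wf; [left|right].
  by move=> g gG; rewrite word_prob_subg // unif -cardsT -(card_isog (isog_subg G)).
exists ((2 * r)%:Z - 1) => g gG.
by rewrite word_prob_subg // wr comm_dist_subg subgK // comm_dist_zeta.
Qed.
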